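(* Let $(X,\tau,\mathfrak a)$ and $(Y,\sigma,\mathfrak b)$ be aura topological spaces and let $f:X\to Y$ be aura-continuous. If $A,B\subseteq X$ satisfy $A\equiv_{\mathfrak a}B$, then $f(A)\equiv_{\mathfrak b}f(B)$. Hence there is a well-defined map $$\overline f:\mathsf L_{\mathfrak a}(X)\to\mathsf L_{\mathfrak b}(Y),\qquad [A]_{\mathfrak a}\longmapsto[f(A)]_{\mathfrak b}.$$
   Context: An aura topological space is a triple $(X,\tau,\mathfrak a)$ where $X$ is a nonempty set, $(X,\tau)$ is a topological space and $\mathfrak a:X\to\tau$ (the scope function) satisfies $x\in\mathfrak a(x)$ for every $x\in X$. A set $U\subseteq X$ is $\mathfrak a$-open if $\{x\in U:\mathfrak a(x)\subseteq U\}=U$; the family of all $\mathfrak a$-open sets is denoted $\tau_{\mathfrak a}$ and is known to be a topology on $X$. For $A,B\subseteq X$, $A\equiv_{\mathfrak a}B$ means that for every $U\in\tau_{\mathfrak a}$, $A\subseteq U\iff B\subseteq U$; $[A]_{\mathfrak a}$ is the equivalence class of $A$, and $\mathsf L_{\mathfrak a}(X)=\mathcal P(X)/{\equiv_{\mathfrak a}}$. The same notation is used for $(Y,\sigma,\mathfrak b)$. A map $f:(X,\tau,\mathfrak a)\to(Y,\sigma,\mathfrak b)$ is aura-continuous if it is continuous from $(X,\tau_{\mathfrak a})$ to $(Y,\tau_{\mathfrak b})$. *)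

(* Defs.v *)
From HB Require Import structures.
From mathcomp Require Import all_boot all_order.
From mathcomp Require Import boolp classical_sets filter topology_structure.

Set Implicit Arguments.
Unset Strict Implicit.
Unset Printing Implicit Defensive.

Local Open Scope classical_set_scope.
Local Open Scope quotient_scope.

(* The aura space (X, tau, scope), where tau is the topology carried by X. *)
Record aura (X : topologicalType) := Aura {
  scope :> X -> set X;
  aura_nonempty : [set: X] !=set0;
  open_scope : forall x, open (scope x);
  mem_scope : forall x, scope x x }.

Definition aura_open (X : topologicalType) (a : aura X) : set (set X) :=
  [set U | [set x | U x /\ a x `<=` U] = U].

Lemma aura_openP (X : topologicalType) (a : aura X) (U : set X) :
  aura_open a U <-> forall x, U x -> a x `<=` U.
Proof.
split=> [UE x|aU]; first by rewrite -{1}UE => -[].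
by apply/seteqP; split=> [x []//|x Ux]; split=> //; exact: aU.
Qed.

Lemma aura_openT (X : topologicalType) (a : aura X) : aura_open a setT.
Proof. by apply/aura_openP. Qed.

Lemma aura_openI (X : topologicalType) (a : aura X) :
  setI_closed (aura_open a).
Proof.
move=> U V /aura_openP aU /aura_openP aV; apply/aura_openP => x [Ux Vx] y axy.
by split; [exact: aU axy|exact: aV axy].
Qed.

Lemma aura_open_bigU (X : topologicalType) (a : aura X) (I : Type)
    (F : I -> set X) :
  (forall i, aura_open a (F i)) -> aura_open a (\bigcup_i F i).
Proof.
move=> aF; apply/aura_openP => x [i _ Fix] y axy; exists i => //.
by move/aura_openP: (aF i) => /(_ x Fix); apply.
Qed.

(* A copy of X carrying the topology tau_a instead of tau. *)
Definition aura_space (X : topologicalType) (a : aura X) : Type := X.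

HB.instance Definition _ (X : topologicalType) (a : aura X) :=
  Choice.copy (aura_space a) X.
HB.instance Definition _ (X : topologicalType) (a : aura X) :=
  isOpenTopological.Build (aura_space a)
    (@aura_openT X a) (@aura_openI X a) (@aura_open_bigU X a).

Lemma open_aura_spaceE (X : topologicalType) (a : aura X) :
  @open (aura_space a) = aura_open a.
Proof.
apply/seteqP; split=> U; rewrite openE => oU.
  apply/aura_openP => x Ux y axy; have [B [aB Bx BU]] := oU x Ux.
  by apply: BU; exact: (iffLR (aura_openP a B) aB x Bx).
by move=> x Ux; exists U; split.
Qed.

Definition aura_continuous (X Y : topologicalType) (a : aura X) (b : aura Y)
    (f : X -> Y) : Prop :=
  continuous (f : aura_space a -> aura_space b).

Definition aura_equiv (X : topologicalType) (a : aura X) (A B : set X) : Prop :=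
  forall U, aura_open a U -> (A `<=` U <-> B `<=` U).

Definition aura_equivb (X : topologicalType) (a : aura X) : rel (set X) :=
  fun A B => `[< aura_equiv a A B >].

Lemma aura_equivb_refl (X : topologicalType) (a : aura X) :
  reflexive (aura_equivb a).
Proof. by move=> A; apply/asboolP. Qed.

Lemma aura_equivb_sym (X : topologicalType) (a : aura X) :
  symmetric (aura_equivb a).
Proof.
by move=> A B; apply/asboolP/asboolP => AB U /AB AUBU; apply: iff_sym.
Qed.

Lemma aura_equivb_trans (X : topologicalType) (a : aura X) :
  transitive (aura_equivb a).
Proof.
move=> B A C /asboolP AB /asboolP BC; apply/asboolP => U aU.
exact: iff_trans (AB U aU) (BC U aU).
Qed.

Canonical aura_equiv_rel (X : topologicalType) (a : aura X) :=
  EquivRel (aura_equivb a) (aura_equivb_refl a) (aura_equivb_sym a)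
    (@aura_equivb_trans X a).

(* The quotient L_a(X) of the powerset of X. *)
Definition aura_quot (X : topologicalType) (a : aura X) : Type :=
  {eq_quot (aura_equiv_rel a)}.

(* The class [A]_a. *)
Definition aura_class (X : topologicalType) (a : aura X) (A : set X) :
    aura_quot a :=
  \pi_({eq_quot (aura_equiv_rel a)}) A.

Lemma aura_classP (X : topologicalType) (a : aura X) (A B : set X) :
  aura_class a A = aura_class a B <-> aura_equiv a A B.
Proof.
split=> [/eqquotP/asboolP //|AB].
by apply/eqquotP; apply/asboolP.
Qed.

Lemma aura_class_surj (X : topologicalType) (a : aura X) (q : aura_quot a) :
  exists A, aura_class a A = q.
Proof. by exists (repr (q : {eq_quot (aura_equiv_rel a)})); exact: reprK. Qed.

(* Main.v *)
Require Import Defs.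
From HB Require Import structures.
From mathcomp Require Import all_boot all_order.
From mathcomp Require Import boolp classical_sets filter topology_structure.

Local Open Scope classical_set_scope.

(** The relation [aura_equiv] only sees a set through the aura-open sets that
contain it, and images are adjoint to preimages: [f @` A `<=` V] holds exactly
when [A `<=` f @^-1` V]. Continuity makes [f @^-1` V] aura-open whenever [V]
is, so an aura-open superset test on [f @` A] is an aura-open superset test
on [A] ([aura_equiv_image]). The induced map on quotients takes the class of
the image of a chosen representative; surjectivity of [aura_class] makes it
the only candidate. *)

Lemma aura_open_preimage (X Y : topologicalType) (a : aura X) (b : aura Y)
    (f : X -> Y) (V : set Y) :
  aura_continuous a b f -> aura_open b V -> aura_open a (f @^-1` V).
Proof.
move=> /continuousP fC; rewrite -!open_aura_spaceE; exact: fC.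
Qed.

Lemma aura_equiv_image (X Y : topologicalType) (a : aura X) (b : aura Y)
    (f : X -> Y) (A B : set X) :
  aura_continuous a b f ->
  aura_equiv a A B -> aura_equiv b (f @` A) (f @` B).
Proof.
move=> fC AB V bV; rewrite !image_sub.
exact: AB (aura_open_preimage _ _ _ _ _ _ fC bV).
Qed.

Theorem theorem8p2 (X Y : topologicalType) (a : aura X) (b : aura Y)
    (f : X -> Y) (fC : aura_continuous a b f) :
  (forall A B : set X,
     aura_equiv a A B -> aura_equiv b (f @` A) (f @` B)) /\
  (exists! fbar : aura_quot a -> aura_quot b,
     forall A : set X, fbar (aura_class a A) = aura_class b (f @` A)).
Proof.
split=> [A B|]; first exact: aura_equiv_image.
have [r rK] := choice (@aura_class_surj X a).
exists (fun q => aura_class b (f @` r q)); split=> [A|g gE].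
  apply/aura_classP; apply: (aura_equiv_image _ _ _ _ _ _ _ fC).
  by apply/aura_classP; rewrite rK.
by apply/funext => q; rewrite -gE rK.
Qed.
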